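(* Let $\mathfrak n=\mathfrak n_{-2}\oplus\mathfrak n_{-1}$ be a real $M$-type algebra with $\dim_{\mathbb R}\mathfrak n_{-2}\geq 3$ which satisfies the following condition (C): there exist three linearly independent vectors $z_1,z_2,z_3\in\mathfrak n_{-2}$ such that the maps $J_{z_1},J_{z_2},J_{z_3}$ are non-degenerate and $J_{z_i}J_{z_j}=\sigma_{ij}J_{z_j}J_{z_i}$ for all $i,j\in\{1,2,3\}$, where $\sigma_{ij}\in\{-1,1\}$ and $\sigma_{12}\sigma_{13}\sigma_{23}=-1$. Then $\mathfrak n$ is rigid.
   Context: A graded 2-step nilpotent Lie algebra $\mathfrak n=\mathfrak n_{-2}\oplus\mathfrak n_{-1}$ has $[\mathfrak n_{-1},\mathfrak n_{-1}]=\mathfrak n_{-2}$ and $\mathfrak n_{-2}$ central; it is assumed fundamental, i.e. the center of $\mathfrak n$ is exactly $\mathfrak n_{-2}$ (no nonzero element of $\mathfrak n_{-1}$ is central). An $M$-type algebra is such an $\mathfrak n$ together with a non-degenerate symmetric bilinear form $\langle\cdot,\cdot\rangle$ on $\mathfrak n$ whose restriction to $\mathfrak n_{-2}$ is non-degenerate and for which $\mathfrak n_{-2}\perp\mathfrak n_{-1}$. The $J$-map $J\colon\mathfrak n_{-2}\to\operatorname{End}(\mathfrak n_{-1})$ is defined by $\langle J_zx,y\rangle=\langle z,[x,y]\rangle$ for all $x,y\in\mathfrak n_{-1}$, $z\in\mathfrak n_{-2}$. The Tanaka prolongation of $\mathfrak n$ is the maximal graded Lie algebra $\hat{\mathfrak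 n}=\bigoplus_{i\ge -2}\hat{\mathfrak n}_i$ with $\hat{\mathfrak n}_{-2}\oplus\hat{\mathfrak n}_{-1}=\mathfrak n$ (as graded Lie algebras) such that for $k\ge0$ any $X\in\hat{\mathfrak n}_k$ with $[X,\mathfrak n_{-1}]=0$ is zero. $\mathfrak n$ is rigid (of finite type) if $\hat{\mathfrak n}$ is finite dimensional, and of infinite type otherwise. *)

(* Defs.v *)
From HB Require Import structures.
From mathcomp Require Import all_boot all_order all_algebra.
From mathcomp Require Import reals.
Set Implicit Arguments. Unset Strict Implicit. Unset Printing Implicit Defensive.
Import Order.TTheory GRing.Theory Num.Theory.
Local Open Scope ring_scope.

Definition lin1 (R : realType) (U W : lmodType R) (X : Type) (f : U -> X -> W) :=
  forall (a : R) u u' x, f (a *: u + u') x = a *: f u x + f u' x.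

Definition linmap (R : realType) (U W : lmodType R) (f : U -> W) :=
  forall (a : R) u u', f (a *: u + u') = a *: f u + f u'.

(* n = n_{-2} (+) n_{-1}, n_{-1} = V1, n_{-2} = V2 ; the bracket on n_{-1}
   with values in n_{-2}; n_{-2} central.  Graded, 2-step, generated by
   n_{-1} ([n_{-1},n_{-1}] = n_{-2}) and fundamental (center = n_{-2}). *)
Definition two_step_fundamental (R : realType) (V1 V2 : vectType R)
    (br : V1 -> V1 -> V2) :=
  [/\ lin1 br,
      (forall x y, br x y = - br y x),
      (forall w : V2, exists s : seq (V1 * V1), w = \sum_(p <- s) br p.1 p.2)
    & (forall x, (forall y, br x y = 0) -> x = 0)].

Definition nondeg_sym_form (R : realType) (V : lmodType R) (B : V -> V -> R) :=
  [/\ (forall (a : R) u u' y, B (a *: u + u') y = a * B u y + B u' y),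
      (forall x y, B x y = B y x)
    & (forall x, (forall y, B x y = 0) -> x = 0)].

(* M-type algebra: the form on n is the orthogonal sum of B2 on n_{-2} and
   B1 on n_{-1} (n_{-2} \perp n_{-1}); it is non-degenerate and its
   restriction to n_{-2} is non-degenerate, i.e. B1 and B2 are. *)
Definition Mtype (R : realType) (V1 V2 : vectType R) (br : V1 -> V1 -> V2)
    (B1 : V1 -> V1 -> R) (B2 : V2 -> V2 -> R) :=
  [/\ two_step_fundamental br, nondeg_sym_form B1 & nondeg_sym_form B2].

Definition is_Jmap (R : realType) (V1 V2 : vectType R) (br : V1 -> V1 -> V2)
    (B1 : V1 -> V1 -> R) (B2 : V2 -> V2 -> R) (J : V2 -> V1 -> V1) :=
  forall z x y, B1 (J z x) y = B2 z (br x y).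

Definition condition_C (R : realType) (V1 V2 : vectType R) (J : V2 -> V1 -> V1) :=
  exists (z : 'I_3 -> V2) (sigma : 'I_3 -> 'I_3 -> R),
    [/\ (forall a : 'I_3 -> R, \sum_(i < 3) a i *: z i = 0 -> forall i, a i = 0),
        (forall i x, J (z i) x = 0 -> x = 0),
        (forall i j x, J (z i) (J (z j) x) = sigma i j *: J (z j) (J (z i) x)),
        (forall i j, sigma i j = 1 \/ sigma i j = -1)
      & sigma (inord 0) (inord 1) * sigma (inord 0) (inord 2)
          * sigma (inord 1) (inord 2) = -1].

Definition lie_bracket (R : realType) (L : lmodType R) (b : L -> L -> L) :=
  [/\ lin1 b, (forall x y, b x y = - b y x)
    & (forall x y w, b x (b y w) + b y (b w x) + b w (b x y) = 0)].

Definition subspace (R : realType) (L : lmodType R) (P : L -> Prop) :=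
  P 0 /\ forall (a : R) x y, P x -> P y -> P (a *: x + y).

(* (L, b) contains the graded Lie algebra  g = (+)_{i >= -2} g i  (the g i are
   independent subspaces, [g i, g j] <= g (i+j)), whose negative part
   g(-2) (+) g(-1) is identified with n through i2, i1 as graded Lie algebras,
   and which satisfies the Tanaka transitivity condition:
   X in g k, k >= 0, [X, g(-1)] = 0  ==>  X = 0. *)
Definition transitive_graded_ext (R : realType) (V1 V2 : vectType R)
    (br : V1 -> V1 -> V2) (L : lmodType R) (b : L -> L -> L)
    (g : int -> L -> Prop) (i1 : V1 -> L) (i2 : V2 -> L) :=
  lie_bracket b /\
  (forall k, subspace (g k)) /\
  (forall i j x y, g i x -> g j y -> g (i + j) (b x y)) /\
  (forall i x, i < -2 -> g i x -> x = 0) /\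
  (forall (s : seq int) (f : int -> L), uniq s -> (forall i, g i (f i)) ->
      \sum_(i <- s) f i = 0 -> forall i, i \in s -> f i = 0) /\
  (linmap i1 /\ linmap i2 /\ injective i1 /\ injective i2 /\
   (forall X, g (-1) X <-> exists v, X = i1 v) /\
   (forall X, g (-2) X <-> exists v, X = i2 v)) /\
  (forall x y, i2 (br x y) = b (i1 x) (i1 y)) /\
  (forall k X, 0 <= k -> g k X -> (forall Y, g (-1) Y -> b X Y = 0) -> X = 0).

Definition graded_finite_dim (R : realType) (L : lmodType R) (g : int -> L -> Prop) :=
  exists s : seq L, forall i X, g i X ->
    exists c : 'I_(size s) -> R, X = \sum_(j < size s) c j *: s`_j.

(* rigid: the Tanaka prolongation (the maximal transitive graded extension,
   which contains every transitive graded extension) is finite dimensional;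
   equivalently every transitive graded extension is finite dimensional. *)
Definition rigid (R : realType) (V1 V2 : vectType R) (br : V1 -> V1 -> V2) :=
  forall (L : lmodType R) (b : L -> L -> L) (g : int -> L -> Prop)
         (i1 : V1 -> L) (i2 : V2 -> L),
    transitive_graded_ext br b g i1 i2 -> graded_finite_dim g.

(* Main.v *)
Require Import Defs.
From HB Require Import structures.
From mathcomp Require Import all_boot all_order all_algebra.
From mathcomp Require Import boolp reals.
From mathcomp Require Import zify ring lra.
Import Order.TTheory GRing.Theory Num.Theory.
Local Open Scope ring_scope.
Set Implicit Arguments.
Unset Strict Implicit.
Unset Printing Implicit Defensive.

(* Write [h_k] for the centralizer of [n_{-2}] in degree [k] of a transitive
   extension.  An element of [h_1] is a symmetric bilinear map [A] on [n_{-1}]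
   for which [T_i(x, y, w) = <z_i, [A(x, y), w]>] is totally symmetric; the three
   forms [T_i] are related by the [J_{z_i}], and condition (C) makes
   [J_{z_3}^-1 J_{z_1}] and [J_{z_3}^-1 J_{z_2}] anticommuting and self-adjoint
   for [T_3] in any two slots, which forces [T_3 = 0].  So [h_1 = 0].

   Vanishing of [h_1] implies finite dimension, by releasing the centralizing
   conditions one bracket at a time.  If the centralizer of [z = [x, y]], [z_1],
   ..., [z_m] vanishes in large degree, then on the centralizer [G] of
   [z_1], ..., [z_m] the map [ad z] is injective in large degree; the dimensions
   of the [G_k] then stabilize, so [ad z] becomes bijective, and
   [(ad z)^-1 [ad x, ad y] = id] has trace zero on two consecutive degrees:
   [G] vanishes in large degree too. *)

(** * Elementary consequences of linearity *)

Section Linmap.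
Variables (R : realType) (U W : lmodType R) (f : U -> W).
Hypothesis fL : linmap f.

Lemma linmapD u v : f (u + v) = f u + f v.
Proof. by have := fL 1 u v; rewrite !scale1r. Qed.

Lemma linmap0 : f 0 = 0.
Proof. by apply: (addrI (f 0)); rewrite -linmapD !addr0. Qed.

Lemma linmapZ a u : f (a *: u) = a *: f u.
Proof. by have := fL a u 0; rewrite !addr0 linmap0 addr0. Qed.

Lemma linmapN u : f (- u) = - f u.
Proof. by rewrite -scaleN1r linmapZ scaleN1r. Qed.

Lemma linmapB u v : f (u - v) = f u - f v.
Proof. by rewrite linmapD linmapN. Qed.

Lemma linmap_sum (I : Type) (s : seq I) (F : I -> U) :
  f (\sum_(i <- s) F i) = \sum_(i <- s) f (F i).
Proof. by elim/big_rec2: _ => [|i y1 y2 _ <-]; rewrite ?linmap0 ?linmapD. Qed.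

End Linmap.

Lemma injective_endo_surj (R : realType) (V : vectType R) (f : V -> V) :
  linmap f -> (forall x, f x = 0 -> x = 0) -> forall y, exists x, f x = y.
Proof.
move=> fL finj y.
pose g : {linear V -> V} := HB.pack f (GRing.isLinear.Build _ _ _ _ f fL).
have k0 : lker (linfun g) == 0%VS.
  by apply/lker0P => u v; rewrite !lfunE /= => E; apply/subr0_eq/finj; rewrite linmapB // E subrr.
by exists ((linfun g)^-1%VF y); have := lker0_lfunVK k0 y; rewrite lfunE.
Qed.

(** * Coordinates on finite-dimensional subspaces of [L] *)

Section Coordinates.
Variables (R : realType) (L : lmodType R).

Lemma subspace0 (P : L -> Prop) : subspace P -> P 0.
Proof. by case. Qed.

Lemma subspace_sum (P : L -> Prop) : subspace P ->
  forall (I : Type) (s : seq I) (a : I -> R) (F : I -> L),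
  (forall i, P (F i)) -> P (\sum_(i <- s) a i *: F i).
Proof.
move=> [P0 PD] I s a F PF; elim/big_rec: _ => // i x _ Px; exact: PD.
Qed.

(** [L] may be infinite dimensional, so finite dimension of [P] is witnessed by a map defined on all
    of [L] but required to be linear and injective on [P] alone. *)
Definition embeds (P : L -> Prop) (N : nat) (c : L -> 'rV[R]_N) :=
  (forall a x y, P x -> P y -> c (a *: x + y) = a *: c x + c y) /\
  (forall x, P x -> c x = 0 -> x = 0).

Definition fin_dim (P : L -> Prop) := exists N (c : L -> 'rV[R]_N), embeds P c.

Definition coordinates (P : L -> Prop) (r : nat) (phi : 'rV[R]_r -> L)
    (psi : L -> 'rV[R]_r) :=
  [/\ linmap phi, (forall u, P (phi u)), cancel phi psi
    & (forall x, P x -> phi (psi x) = x)].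

Definition has_dim (P : L -> Prop) (r : nat) := exists phi psi, @coordinates P r phi psi.

Lemma coordinates_linear (P : L -> Prop) r phi psi : @coordinates P r phi psi ->
  forall a x y, P x -> P y -> psi (a *: x + y) = a *: psi x + psi y.
Proof.
case=> phiL _ phiK psiK a x y Px Py.
by rewrite -{1}(psiK x Px) -{1}(psiK y Py) -phiL phiK.
Qed.

Lemma embeds_comb (P : L -> Prop) N (c : L -> 'rV[R]_N) : subspace P -> embeds P c ->
  forall r (X : 'I_r -> L) (u : 'rV[R]_r), (forall i, P (X i)) ->
  c (\sum_i u 0 i *: X i) = u *m \matrix_i c (X i).
Proof.
move=> sP [cL _] r X u PX.
have c0 : c 0 = 0.
  have P0 := subspace0 sP.
  by have := cL (-1) 0 0 P0 P0; rewrite scaler0 addr0 scaleN1r addNr.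
rewrite mulmx_sum_row.
(* Since [c] is linear on [P] only, membership of the partial sums is carried along with their
   image. *)
pose K x v := P x /\ c x = v.
suff [] : K (\sum_i u 0 i *: X i) (\sum_i u 0 i *: row i (\matrix_i c (X i))) by [].
elim/big_rec2: _ => [|i v x _ [Px Ex]]; first by split=> //; exact: subspace0.
split; first by apply: sP.2.
by rewrite cL // Ex rowK.
Qed.

(** A family in [P] with independent coordinate rows has at most [N] members; one of maximal size is
    a basis. *)
Lemma fin_dim_has_dim (P : L -> Prop) : subspace P -> fin_dim P -> exists r, has_dim P r.
Proof.
move=> sP [N [c [cL cinj]]].
have cc : embeds P c by [].
pose Q r := `[< exists X : 'I_r -> L, (forall i, P (X i)) /\ row_free (\matrix_i c (X i)) >].
have Q0 : exists r, Q r.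
  exists 0%N; apply/asboolP; exists (fun _ => 0); split=> [_|]; first exact: subspace0.
  by rewrite /row_free; have := rank_leq_row (\matrix_(i < 0) c 0); rewrite leqn0.
have QN r : Q r -> (r <= N)%N.
  by move=> /asboolP[X [_ /eqP <-]]; exact: rank_leq_col.
case: (ex_maxnP Q0 QN) => r /asboolP[X [PX Xfree]] rmax.
pose M := \matrix_i c (X i); pose phi (u : 'rV[R]_r) := \sum_i u 0 i *: X i.
have phiP u : P (phi u) by exact: subspace_sum.
have cphi u : c (phi u) = u *m M by rewrite /phi (embeds_comb sP cc).
have span x : P x -> (c x <= M)%MS.
  move=> Px; apply/negPn/negP => nsub.
  (* Otherwise [x], placed in front of the family, would give [r.+1] independent rows. *)
  suff : Q r.+1 by move/rmax; rewrite ltnn.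
  apply/asboolP; exists (fun i => oapp X x (unlift ord0 i)); split=> [i|].
    by case: (unlift _ _).
  have -> : \matrix_i c (oapp X x (unlift ord0 i)) = col_mx (c x) M.
    apply/row_matrixP => i; rewrite rowK; case: (unliftP ord0 i) => [k|] -> /=.
      rewrite (_ : lift ord0 k = rshift 1 k); last exact/val_inj.
      by rewrite (@rowKd _ 1 r) rowK.
    rewrite (_ : ord0 = lshift r (0 : 'I_1)); last exact/val_inj.
    by symmetry; apply: etrans (@rowKu _ 1 r _ _ _ _) (row_id _ _).
  have lt : (M < c x + M)%MS by rewrite /ltmx addsmxSr addsmx_sub submx_refl andbT.
  move: lt; rewrite ltmxErank => /andP[_].
  rewrite (eqP Xfree) addsmxE => lt_r.
  by rewrite /row_free eqn_leq lt_r andbT; exact: (@rank_leq_row _ (1 + r)).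
(* The pseudo-inverse of [M] reads off coefficients exactly for rows in the row space of [M], which
   contains [c x] for every [x] in [P]. *)
exists r, phi, (fun x => c x *m pinvmx M); split=> //.
- move=> a u v; rewrite /phi scaler_sumr -big_split; apply: eq_bigr => i _ /=.
  by rewrite !mxE scalerDl scalerA.
- by move=> u; apply: (row_free_inj Xfree); rewrite -/M mulmxKpV ?cphi ?submxMl.
move=> x Px; apply/subr0_eq.
have E : phi (c x *m pinvmx M) - x = (-1) *: x + phi (c x *m pinvmx M).
  by rewrite scaleN1r addrC.
rewrite E; apply: cinj; first exact: sP.2.
by rewrite cL // cphi mulmxKpV ?span // scaleN1r addNr.
Qed.

End Coordinates.

(** * Matrices of linear maps between subspaces, acting on row vectors *)

Section MatrixOfMap.
Variables (R : realType) (L : lmodType R).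

Definition map_mx_of r s (phi : 'rV[R]_r -> L) (psi : L -> 'rV[R]_s) (f : L -> L) :=
  lin1_mx (psi \o f \o phi).

Variables (P Q : L -> Prop) (r s : nat).
Variables (phi : 'rV[R]_r -> L) (psi : L -> 'rV[R]_r).
Variables (phi' : 'rV[R]_s -> L) (psi' : L -> 'rV[R]_s).
Hypotheses (cP : coordinates P phi psi) (cQ : coordinates Q phi' psi').
Variable f : L -> L.
Hypotheses (fL : linmap f) (fPQ : forall x, P x -> Q (f x)).

Lemma map_mx_ofE u : u *m map_mx_of phi psi' f = psi' (f (phi u)).
Proof.
case: (cP) => phiL phiP _ _.
pose h := psi' \o f \o phi.
have hL : linear h.
  by move=> a u1 u2; rewrite /h /= phiL fL (coordinates_linear cQ) //; apply: fPQ.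
pose g : {linear 'rV[R]_r -> 'rV[R]_s} := HB.pack h (GRing.isLinear.Build _ _ _ _ h hL).
exact: (mul_rV_lin1 g).
Qed.

Lemma map_mx_of_row_free : (forall x, P x -> f x = 0 -> x = 0) ->
  row_free (map_mx_of phi psi' f).
Proof.
case: (cP) => phiL phiP phiK _; case: (cQ) => phiL' _ _ psiK' finj.
apply/inj_row_free => u; rewrite map_mx_ofE => u0.
have : phi u = 0 by apply: finj => //; rewrite -[f _]psiK' ?u0 ?(linmap0 phiL') //; exact: fPQ.
by move/(congr1 psi); rewrite phiK => ->; have := phiK 0; rewrite (linmap0 phiL).
Qed.

End MatrixOfMap.

Lemma map_mx_of_comp (R : realType) (L : lmodType R) (P Q T : L -> Prop) r s t
  phi psi phi' psi' phi'' psi'' f g :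
  @coordinates R L P r phi psi -> @coordinates R L Q s phi' psi' ->
  @coordinates R L T t phi'' psi'' ->
  linmap f -> (forall x, P x -> Q (f x)) -> linmap g -> (forall x, Q x -> T (g x)) ->
  forall u, u *m (map_mx_of phi psi' f *m map_mx_of phi' psi'' g) = psi'' (g (f (phi u))).
Proof.
move=> cP cQ cT fL fPQ gL gQT u; case: (cP) => _ phiP _ _; case: (cQ) => _ _ _ psiK'.
by rewrite mulmxA (map_mx_ofE cP cQ) // (map_mx_ofE cQ cT) // psiK' //; apply: fPQ.
Qed.

Lemma has_dim_leq (R : realType) (L : lmodType R) (P Q : L -> Prop) r s (f : L -> L) :
  has_dim P r -> has_dim Q s -> linmap f -> (forall x, P x -> Q (f x)) ->
  (forall x, P x -> f x = 0 -> x = 0) -> (r <= s)%N.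
Proof.
move=> [phi [psi cP]] [phi' [psi' cQ]] fL fPQ finj.
by have /eqP <- := map_mx_of_row_free cP cQ fL fPQ finj; exact: rank_leq_col.
Qed.

(** Multiply the two commutator relations by [invmx Z1] and [invmx Z2] and take traces. Since
    [X3 *m invmx Z2 = invmx Z1 *m X1], and likewise for [Y], cyclicity of the trace makes the
    left-hand sides opposite, so [p + q] vanishes in characteristic 0. *)
Lemma trace_heisenberg (R : realType) p q (X1 Y1 X3 Y3 : 'M[R]_(p, q))
    (X2 Y2 : 'M[R]_(q, p)) (Z1 : 'M[R]_p) (Z2 : 'M[R]_q) :
  Z1 \in unitmx -> Z2 \in unitmx ->
  Y1 *m X2 - X1 *m Y2 = Z1 -> Y2 *m X3 - X2 *m Y3 = Z2 ->
  X1 *m Z2 = Z1 *m X3 -> Y1 *m Z2 = Z1 *m Y3 -> (p + q = 0)%N.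
Proof.
move=> u1 u2 E1 E2 EX EY.
have X3E : X3 *m invmx Z2 = invmx Z1 *m X1.
  by rewrite -[LHS](mulKmx u1) (mulmxA Z1) -EX -mulmxA mulmxV // mulmx1.
have Y3E : Y3 *m invmx Z2 = invmx Z1 *m Y1.
  by rewrite -[LHS](mulKmx u1) (mulmxA Z1) -EY -mulmxA mulmxV // mulmx1.
have tp : p%:R = \tr (invmx Z1 *m Y1 *m X2) - \tr (invmx Z1 *m X1 *m Y2).
  by rewrite -mxtrace1 -(mulVmx u1) -{2}E1 mulmxBr !mulmxA raddfB.
have tq : q%:R = \tr (invmx Z1 *m X1 *m Y2) - \tr (invmx Z1 *m Y1 *m X2).
  rewrite -mxtrace1 -(mulmxV u2) -{1}E2 mulmxBl -!mulmxA X3E Y3E raddfB /=.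
  by rewrite (mxtrace_mulC Y2) (mxtrace_mulC X2) -!mulmxA.
apply/eqP; rewrite -(@pnatr_eq0 R) natrD tp tq.
by apply/eqP; ring.
Qed.


(** * Graded operators with [[x, y] = z] and [z] commuting with [x] and [y] *)

Section GradedHeisenberg.
Variables (R : realType) (L : lmodType R) (G : nat -> L -> Prop) (x y z : L -> L).
Hypotheses (subG : forall k, subspace (G k)) (finG : forall k, fin_dim (G k)).
Hypotheses (xL : linmap x) (yL : linmap y) (zL : linmap z).
Hypotheses (xG : forall k X, G k.+1 X -> G k (x X))
  (yG : forall k X, G k.+1 X -> G k (y X)) (zG : forall k X, G k.+2 X -> G k (z X)).
Hypotheses (xyz : forall k X, G k.+2 X -> x (y X) - y (x X) = z X)
  (zx : forall k X, G k.+3 X -> z (x X) = x (z X))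
  (zy : forall k X, G k.+3 X -> z (y X) = y (z X)).

(* Where [z] is bijective, [z^-1 x y - z^-1 y x = id] on [G k.+3] and on
   [G k.+2]; the traces of the two left-hand sides are opposite. *)
Lemma has_dim_heisenberg k p q :
  has_dim (G k.+3) p -> has_dim (G k.+2) q -> has_dim (G k.+1) p -> has_dim (G k) q ->
  (forall X, G k.+3 X -> z X = 0 -> X = 0) ->
  (forall X, G k.+2 X -> z X = 0 -> X = 0) -> p = 0%N.
Proof.
move=> [f3 [h3 c3]] [f2 [h2 c2]] [f1 [h1 c1]] [f0 [h0 c0]] inj3 inj2.
have E3 := map_mx_ofE c3; have E2 := map_mx_ofE c2.
suff : (p + q = 0)%N by move/eqP; rewrite addn_eq0 => /andP[/eqP].
have [_ f3G _ _] := c3; have [_ f2G _ _] := c2.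
have lin1 := coordinates_linear c1; have lin0 := coordinates_linear c0.
apply: (@trace_heisenberg R p q (map_mx_of f3 h2 x) (map_mx_of f3 h2 y)
  (map_mx_of f1 h0 x) (map_mx_of f1 h0 y) (map_mx_of f2 h1 x) (map_mx_of f2 h1 y)
  (map_mx_of f3 h1 z) (map_mx_of f2 h0 z)).
- by rewrite -row_free_unit (map_mx_of_row_free c3 c1) //; apply: zG.
- by rewrite -row_free_unit (map_mx_of_row_free c2 c0) //; apply: zG.
- apply/row_matrixP => i; rewrite rowE [RHS]rowE mulmxBr.
  rewrite (map_mx_of_comp c3 c2 c1) ?(map_mx_of_comp c3 c2 c1) //; auto.
  rewrite (map_mx_ofE c3 c1) //; auto.
  rewrite -(xyz (f3G _)) -[X in _ = h1 X]addrC -scaleN1r lin1 ?scaleN1r 1?addrC //; auto.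
- apply/row_matrixP => i; rewrite rowE [RHS]rowE mulmxBr.
  rewrite (map_mx_of_comp c2 c1 c0) ?(map_mx_of_comp c2 c1 c0) //; auto.
  rewrite (map_mx_ofE c2 c0) //; auto.
  rewrite -(xyz (f2G _)) -[X in _ = h0 X]addrC -scaleN1r lin0 ?scaleN1r 1?addrC //; auto.
- apply/row_matrixP => i; rewrite rowE [RHS]rowE.
  by rewrite (map_mx_of_comp c3 c2 c0) ?(map_mx_of_comp c3 c1 c0) // ?(zx (f3G _)); auto.
- apply/row_matrixP => i; rewrite rowE [RHS]rowE.
  by rewrite (map_mx_of_comp c3 c2 c0) ?(map_mx_of_comp c3 c1 c0) // ?(zy (f3G _)); auto.
Qed.

Lemma graded_heisenberg_vanish K :
  (forall k X, (K <= k)%N -> G k X -> z X = 0 -> X = 0) ->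
  exists k, forall X, G k X -> X = 0.
Proof.
move=> zinj.
have /boolp.choice[r rG] : forall k, exists r, has_dim (G k) r.
  by move=> k; exact: fin_dim_has_dim.
(* Injectivity of [z] makes [r] non-increasing in steps of two from [K] on. Minimizing the sum of
   two consecutive dimensions makes both parities stationary at the same [k], so that [z] is
   bijective on both. *)
pose S k := (r k + r k.+1)%N.
have exS : exists s, `[< exists2 k, (K <= k)%N & s = S k >].
  by exists (S K); apply/asboolP; exists K.
case: (ex_minnP exS) => s /asboolP[k Kk ->] Smin.
have rle j : (K <= j)%N -> (r j.+2 <= r j)%N.
  move=> Kj; apply: (has_dim_leq (rG _) (rG _) zL) => X GX; first exact: zG.
  by apply: zinj GX; rewrite !leqW.
have le0 := rle k Kk; have le1 := rle k.+1 (leqW Kk).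
have Sk : (S k <= S k.+2)%N by apply: Smin; apply/asboolP; exists k.+2; rewrite // !leqW.
have r2 : r k.+2 = r k by apply/eqP; rewrite eqn_leq le0; move: Sk le1; rewrite /S; lia.
have r3 : r k.+3 = r k.+1 by apply/eqP; rewrite eqn_leq le1; move: Sk le0; rewrite /S; lia.
have G3 := rG k.+3; have G2 := rG k.+2; rewrite r2 in G2; rewrite r3 in G3.
have r0 : r k.+1 = 0%N.
  apply: (has_dim_heisenberg G3 G2 (rG _) (rG _)) => X; apply: zinj; rewrite !leqW //.
exists k.+1 => X GX; have := rG k.+1; rewrite r0 => -[phi [psi [phiL _ _ psiK]]].
by rewrite -(psiK _ GX) (thinmx0 (psi X)) (linmap0 phiL).
Qed.

End GradedHeisenberg.

(** * Criteria for finite dimension, and spanning lists *)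

Section FiniteDimension.
Variables (R : realType) (L : lmodType R).

Lemma linmap_eq0_basis (V : vectType R) (f : V -> L) :
  linmap f -> (forall v, v \in vbasis {:V} -> f v = 0) -> forall v, f v = 0.
Proof.
move=> fL f0 v; rewrite (coord_vbasis (memvf v)) (linmap_sum fL) big1 // => i _.
by rewrite (linmapZ fL) f0 ?scaler0 // mem_nth // size_tuple.
Qed.

Lemma fin_dim_image (V : vectType R) (i : V -> L) (P : L -> Prop) :
  linmap i -> injective i -> (forall X, P X <-> exists v, X = i v) -> fin_dim P.
Proof.
move=> iL iinj PE.
have /boolp.choice[j jE] : forall X, exists v, P X -> X = i v.
  move=> X; case: (boolp.pselect (P X)) => [/PE[v ->]|nP]; first by exists v.
  (* Outside [P] the chosen preimage is 0; linearity of [j] is needed on [P] only. *)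
  by exists 0 => /nP.
exists _, (fun X => \row_k coord (vbasis {:V}) k (j X)); split=> [a X Y PX PY|X PX].
  have PaXY : P (a *: X + Y).
    by apply/PE; exists (a *: j X + j Y); rewrite iL -!jE.
  have -> : j (a *: X + Y) = a *: j X + j Y by apply: iinj; rewrite iL -!jE.
  by apply/rowP => k; rewrite !mxE linearP.
move=> /rowP jX; rewrite (jE X PX) (coord_vbasis (memvf (j X))) big1 ?(linmap0 iL) // => k _.
by have := jX k; rewrite !mxE => ->; rewrite scale0r.
Qed.

(** The coordinates of all the [f i X], laid out in one row of length [n * N], determine [X]. *)
Lemma fin_dim_family (P Q : L -> Prop) n (f : 'I_n -> L -> L) :
  (forall i, linmap (f i)) -> (forall i X, P X -> Q (f i X)) ->
  (forall X, P X -> (forall i, f i X = 0) -> X = 0) -> fin_dim Q -> fin_dim P.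
Proof.
move=> fL fPQ finj [N [c [cL cinj]]].
exists (n * N)%N, (fun X => mxvec (\matrix_i c (f i X))); split=> [a X Y PX PY|X PX].
  rewrite -linearP; congr mxvec; apply/row_matrixP => i.
  by rewrite linearP /= !rowK fL cL //; apply: fPQ.
rewrite -(linear0 mxvec) => /(can_inj mxvecK) /row_matrixP M0.
apply: finj => // i; apply: cinj; first exact: fPQ.
by have := M0 i; rewrite rowK row0.
Qed.

Lemma fin_dim_sub (P Q : L -> Prop) : (forall X, P X -> Q X) -> fin_dim Q -> fin_dim P.
Proof.
move=> PQ [N [c [cL cinj]]]; exists N, c; split=> [a X Y /PQ QX /PQ QY|X /PQ QX].
  exact: cL.
exact: cinj.
Qed.

Definition spanned (s : seq L) (X : L) :=
  exists c : nat -> R, X = \sum_(0 <= i < size s) c i *: s`_i.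

Lemma spanned_cat (s t : seq L) X : spanned s X \/ spanned t X -> spanned (s ++ t) X.
Proof.
case=> -[c ->].
  exists (fun i => if (i < size s)%N then c i else 0); rewrite size_cat.
  rewrite [RHS](@big_cat_nat _ _ _ (size s)) ?leq_addr //= [X in _ + X]big1_seq ?addr0.
    by apply: eq_big_nat => i /andP[_ lt]; rewrite lt nth_cat lt.
  by move=> i; rewrite mem_index_iota => /and3P[_ le _]; rewrite ltnNge le scale0r.
exists (fun i => if (i < size s)%N then 0 else c (i - size s)%N); rewrite size_cat.
rewrite [RHS](@big_cat_nat _ _ _ (size s)) ?leq_addr //= [X in X + _]big1_seq ?add0r.
  symmetry; rewrite -{1}[size s]add0n big_addn addKn; apply: eq_big_nat => i _.
  by rewrite nth_cat !ltnNge leq_addl /= addnK.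
by move=> i; rewrite mem_index_iota => /and3P[_ _ lt]; rewrite lt scale0r.
Qed.

Lemma fin_dim_span (P : L -> Prop) : subspace P -> fin_dim P ->
  exists s : seq L, forall X, P X -> spanned s X.
Proof.
move=> sP /(fin_dim_has_dim sP)[r [phi [psi [phiL _ _ psiK]]]].
pose s := [seq phi (delta_mx 0 i) | i : 'I_r].
have sE : size s = r by rewrite size_map size_enum_ord.
exists s => X PX.
exists (fun i => oapp (psi X 0) 0 (insub i)).
rewrite -{1}(psiK X PX) {1}[psi X]row_sum_delta (linmap_sum phiL) sE big_mkord.
apply: eq_bigr => i _; rewrite (linmapZ phiL) valK /=.
by rewrite (nth_map i) ?size_enum_ord // nth_ord_enum.
Qed.

Lemma span_family (I : eqType) (s : seq I) (P : I -> L -> Prop) :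
  (forall i, subspace (P i)) -> (forall i, fin_dim (P i)) ->
  exists t : seq L, forall X, (exists2 i, i \in s & P i X) -> spanned t X.
Proof.
move=> sP fP; elim: s => [|i s [t IH]]; first by exists [::] => X [i].
have [u uP] := fin_dim_span (sP i) (fP i); exists (u ++ t) => X [j].
rewrite inE => /orP[/eqP ->|js] PX.
  by apply: spanned_cat; left; exact: uP.
by apply: spanned_cat; right; apply: IH; exists j.
Qed.

End FiniteDimension.

(** * Transitive graded extensions and centralizers of elements of [n_{-2}] *)

Section Prolongation.
Variables (R : realType) (V1 V2 : vectType R) (br : V1 -> V1 -> V2).
Variables (L : lmodType R) (b : L -> L -> L) (g : int -> L -> Prop).
Variables (i1 : V1 -> L) (i2 : V2 -> L).
Hypothesis ext : transitive_graded_ext br b g i1 i2.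

Lemma bracketC X Y : b X Y = - b Y X.
Proof. by case: ext => -[]. Qed.

Lemma bracket_linear_r X : linmap (b X).
Proof.
case: ext => -[bL _ _] _ a Y Z.
by rewrite bracketC bL [b X Y]bracketC [b X Z]bracketC scalerN opprD.
Qed.

Lemma bracket_jacobi X Y Z : b X (b Y Z) = b (b X Y) Z + b Y (b X Z).
Proof.
case: ext => -[_ _ /(_ X Y Z) /eqP]; rewrite -addrA addr_eq0 => /eqP -> _.
by rewrite [b Z X]bracketC (linmapN (bracket_linear_r _)) [b Z _]bracketC opprD !opprK addrC.
Qed.

Lemma degree_subspace k : subspace (g k).
Proof. by case: ext => _ []. Qed.

Lemma degree_bracket i j X Y : g i X -> g j Y -> g (i + j) (b X Y).
Proof. by case: ext => _ [_ [+ _]]; apply. Qed.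

Lemma degree_lt i X : i < -2 -> g i X -> X = 0.
Proof. by case: ext => _ [_ [_ [+ _]]]; apply. Qed.

Lemma i1_linear : linmap i1.
Proof. by case: ext => _ [_ [_ [_ [_ [[]]]]]]. Qed.

Lemma i2_linear : linmap i2.
Proof. by case: ext => _ [_ [_ [_ [_ [[? []]]]]]]. Qed.

Lemma i1_inj : injective i1.
Proof. by case: ext => _ [_ [_ [_ [_ [[? [? []]]]]]]]. Qed.

Lemma i2_inj : injective i2.
Proof. by case: ext => _ [_ [_ [_ [_ [[? [? [? []]]]]]]]]. Qed.

Lemma degree_m1 X : g (-1) X <-> exists v, X = i1 v.
Proof. by case: ext => _ [_ [_ [_ [_ [[? [? [? [? []]]]]]]]]]. Qed.

Lemma degree_m2 X : g (-2) X <-> exists v, X = i2 v.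
Proof. by case: ext => _ [_ [_ [_ [_ [[? [? [? [? []]]]]]]]]]. Qed.

Lemma i2_br x y : i2 (br x y) = b (i1 x) (i1 y).
Proof. by case: ext => _ [_ [_ [_ [_ [_ []]]]]]. Qed.

Lemma transitive k X : 0 <= k -> g k X -> (forall v, b (i1 v) X = 0) -> X = 0.
Proof.
case: ext => _ [_ [_ [_ [_ [_ [_ tr]]]]]] k0 gX X0; apply: (tr k) => // Y /degree_m1[v ->].
by rewrite bracketC X0 oppr0.
Qed.

Lemma degree_i1 v : g (-1) (i1 v). Proof. by apply/degree_m1; exists v. Qed.

Lemma degree_i2 w : g (-2) (i2 w). Proof. by apply/degree_m2; exists w. Qed.

(** The bracket lies in degree -3, where the extension is zero. *)
Lemma i2_central w v : b (i2 w) (i1 v) = 0.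
Proof. exact: degree_lt (degree_bracket (degree_i2 w) (degree_i1 v)). Qed.

Lemma ad_i2_i1 w v X : b (i2 w) (b (i1 v) X) = b (i1 v) (b (i2 w) X).
Proof.
by rewrite bracket_jacobi i2_central bracketC (linmap0 (bracket_linear_r _)) oppr0 add0r.
Qed.

Lemma ad_i2_i2 w w' X : b (i2 w) (b (i2 w') X) = b (i2 w') (b (i2 w) X).
Proof.
rewrite bracket_jacobi (degree_lt _ (degree_bracket (degree_i2 w) (degree_i2 w'))) //.
by rewrite bracketC (linmap0 (bracket_linear_r _)) oppr0 add0r.
Qed.

Lemma ad_i2_br x y X : b (i1 x) (b (i1 y) X) - b (i1 y) (b (i1 x) X) = b (i2 (br x y)) X.
Proof. by rewrite bracket_jacobi addrK i2_br. Qed.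

Lemma degree_ad1 k v X : g (k%:Z + 1) X -> g k%:Z (b (i1 v) X).
Proof.
move=> gX; have := degree_bracket (degree_i1 v) gX.
by rewrite (_ : -1 + _ = k%:Z) //; lia.
Qed.

(** The shift by 2 lets a natural number index all degrees from -2 on. In degree at least 0,
    transitivity makes an element determined by its brackets with a basis of [n_{-1}], which lie one
    degree lower. *)
Lemma fin_dim_degree (k : nat) : fin_dim (g (k%:Z - 2)).
Proof.
case: k => [|k].
  by apply: fin_dim_image i2_linear i2_inj _ => X; exact: degree_m2.
elim: k => [|k IH].
  by apply: fin_dim_image i1_linear i1_inj _ => X; exact: degree_m1.
apply: (@fin_dim_family _ _ _ _ (\dim {:V1}) (fun a => b (i1 (vbasis {:V1})`_a))) IH.
- by move=> a; exact: bracket_linear_r.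
- move=> a X gX; have := degree_bracket (degree_i1 (vbasis {:V1})`_a) gX.
  by rewrite (_ : -1 + _ = k.+1%:Z - 2) //; lia.
move=> X gX X0; apply: (transitive _ gX) => [|v]; first by lia.
have fL : linmap (fun v => b (i1 v) X).
  by case: ext => -[bL _ _] _ a u u'; rewrite i1_linear bL.
apply: (linmap_eq0_basis fL) => u /(nthP 0)[i]; rewrite size_tuple => lt <-.
exact: (X0 (Ordinal lt)).
Qed.

(** The list holds pairs rather than elements of [n_{-2}]: each centralized element is then a single
    bracket [br p.1 p.2], whose two factors supply the Heisenberg operators. *)
Definition centralizer (s : seq (V1 * V1)) (k : nat) (X : L) :=
  g k%:Z X /\ forall p, p \in s -> b (i2 (br p.1 p.2)) X = 0.

Lemma subspace_centralizer s k : subspace (centralizer s k).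
Proof.
have [g0 gD] := degree_subspace k%:Z; split=> [|a X Y [gX X0] [gY Y0]].
  by split=> // p _; rewrite (linmap0 (bracket_linear_r _)).
split=> [|p ps]; first exact: gD.
by rewrite bracket_linear_r X0 // Y0 // scaler0 addr0.
Qed.

Lemma centralizer_ad1 s k v X : centralizer s k.+1 X -> centralizer s k (b (i1 v) X).
Proof.
case=> gX X0; split=> [|p ps]; first by apply: degree_ad1; rewrite -PoszD addn1.
by rewrite ad_i2_i1 X0 // (linmap0 (bracket_linear_r _)).
Qed.

Lemma centralizer_ad2 s k w X : centralizer s k.+2 X -> centralizer s k (b (i2 w) X).
Proof.
case=> gX X0; split=> [|p ps]; last by rewrite ad_i2_i2 X0 // (linmap0 (bracket_linear_r _)).
have := degree_bracket (degree_i2 w) gX.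
by rewrite (_ : -2 + _ = k%:Z) //; lia.
Qed.

(** Brackets with [n_{-1}] lower the degree inside the centralizer, so transitivity carries
    vanishing upwards. *)
Lemma centralizer_vanish_leq s j k : (j <= k)%N ->
  (forall X, centralizer s j X -> X = 0) -> forall X, centralizer s k X -> X = 0.
Proof.
move=> /subnK <- j0; elim: (k - j)%N => [|n IH] X; first exact: j0.
rewrite addSn => cX; apply: (transitive _ cX.1) => // v.
by apply: IH; exact: centralizer_ad1.
Qed.

(** The kernel of the bracket with [br p.1 p.2] on the centralizer of [s] is the centralizer of
    [p :: s], hence zero from degree [K] on. *)
Lemma centralizer_drop p s :
  (exists k, forall X, centralizer (p :: s) k X -> X = 0) ->
  exists k, forall X, centralizer s k X -> X = 0.
Proof.
case=> K K0; pose ad v := b (i1 v).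
apply: (@graded_heisenberg_vanish R L (centralizer s) (ad p.1) (ad p.2)
  (b (i2 (br p.1 p.2))) _ _ _ _ _ _ _ _ _ _ _ K).
- exact: subspace_centralizer.
- move=> k; apply: fin_dim_sub (fin_dim_degree k.+2) => X [gX _].
  by rewrite (_ : _ - 2 = k%:Z) //; lia.
- exact: bracket_linear_r.
- exact: bracket_linear_r.
- exact: bracket_linear_r.
- by move=> k X; exact: centralizer_ad1.
- by move=> k X; exact: centralizer_ad1.
- by move=> k X; exact: centralizer_ad2.
- by move=> k X _; exact: ad_i2_br.
- by move=> k X _; exact: ad_i2_i1.
- by move=> k X _; exact: ad_i2_i1.
move=> k X Kk [gX X0] zX; apply: (centralizer_vanish_leq Kk K0); split=> // q.
by rewrite inE => /orP[/eqP ->|/X0].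
Qed.

Lemma degree_vanish s k : (forall X, centralizer s k X -> X = 0) ->
  exists K, forall j X, (K <= j)%N -> g j%:Z X -> X = 0.
Proof.
(* The degree is made existential because it may change each time a pair is dropped; the centralizer
   of the empty list is the whole degree. *)
move=> s0; have {s0} : exists k, forall X, centralizer s k X -> X = 0 by exists k.
elim: s => [[K K0]|p s IH /centralizer_drop]; last exact: IH.
by exists K => j X Kj gX; apply: (centralizer_vanish_leq Kj K0); split.
Qed.

Lemma graded_finite_dim_vanish K :
  (forall j X, (K <= j)%N -> g j%:Z X -> X = 0) -> graded_finite_dim g.
Proof.
move=> K0.
(* After the shift by 2, these [K.+2] indices are the degrees from -2 to [K - 1]. *)
have [s sP] := span_family (iota 0 K.+2) (fun k => degree_subspace (k%:Z - 2)) fin_dim_degree.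
exists s => i X gX.
suff [c ->] : spanned s X by exists c; rewrite big_mkord.
have [lt|ge] := ltP i (-2 : int).
  by rewrite (degree_lt lt gX); exists (fun=> 0); rewrite big1 // => j _; rewrite scale0r.
have [k iE] : exists k : nat, i = k%:Z - 2 by exists (absz (i + 2)); lia.
have [Kk|kK] := leqP K.+2 k.
  rewrite (K0 (k - 2)%N X) //; [|lia|by rewrite (_ : _%:Z = i) //; lia].
  by exists (fun=> 0); rewrite big1 // => j _; rewrite scale0r.
by apply: sP; exists k; rewrite ?mem_iota -?iE.
Qed.

Hypothesis brL : lin1 br.
Hypothesis brC : forall x y, br x y = - br y x.
Hypothesis br_gen : forall w : V2, exists s : seq (V1 * V1), w = \sum_(p <- s) br p.1 p.2.

(* A case of Tanaka's finiteness criterion. *)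
Lemma rigid_criterion :
  (forall X, g 1 X -> (forall w, b (i2 w) X = 0) -> X = 0) -> graded_finite_dim g.
Proof.
move=> h1.
(* Brackets of basis vectors span [n_{-2}], so centralizing this finite list amounts to centralizing
   all of [n_{-2}]. *)
pose s := [seq (x, y) | x <- vbasis {:V1}, y <- vbasis {:V1}].
suff s0 X : centralizer s 1 X -> X = 0.
  by have [K K0] := degree_vanish s0; exact: graded_finite_dim_vanish K0.
case=> gX X0; apply: h1 => // w.
have [t ->] := br_gen w.
have fL : linmap (fun w => b (i2 w) X).
  by case: ext => -[bL _ _] _ a u u'; rewrite i2_linear bL.
rewrite (linmap_sum fL) big1 // => -[x y] _ /=.
have brLl u : linmap (fun v => b (i2 (br v u)) X) by move=> a v v'; rewrite brL fL.
have brLr u : linmap (fun v => b (i2 (br u v)) X).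
  move=> a v v'; rewrite brC brL opprD -scalerN -!(brC u) fL //.
apply: (linmap_eq0_basis (brLl y)) => u us.
apply: (linmap_eq0_basis (brLr u)) => v vs.
by apply: (X0 (u, v)); apply/allpairsP; exists (u, v).
Qed.

End Prolongation.

(** * Symmetric trilinear forms and sign-commuting maps *)

Section SymmetricTrilinear.
Variables (R : realType) (V : vectType R).

(** Let [Q = T (J3 J3 x) (J1 y) (J2 w)]. Exchanging [J1] and [J2] with [J3] between slots turns
    [T (J1 J2 x) (J3 y) (J3 w)] into [s23 * Q] and [T (J2 J1 x) (J3 y) (J3 w)] into [s13 * Q].
    Comparing them through [s12] gives [Q = s12 * s13 * s23 * Q = - Q]. *)
Lemma sym_trilinear_anticommuting_eq0 (T : V -> V -> V -> R) (J : 'I_3 -> V -> V)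
    (s12 s13 s23 : R) (j1 j2 j3 : 'I_3) :
  (forall i, linmap (J i)) -> (forall i x, J i x = 0 -> x = 0) ->
  (forall x, J j1 (J j2 x) = s12 *: J j2 (J j1 x)) ->
  (forall x, J j3 (J j1 x) = s13 *: J j1 (J j3 x)) ->
  (forall x, J j3 (J j2 x) = s23 *: J j2 (J j3 x)) ->
  s23 * s23 = 1 -> s12 * s13 * s23 = -1 ->
  (forall c x y w, T (c *: x) y w = c * T x y w) ->
  (forall x y w, T x y w = T y x w) -> (forall x y w, T x y w = T x w y) ->
  (forall x y w, T x (J j3 y) (J j1 w) = T x (J j1 y) (J j3 w)) ->
  (forall x y w, T x (J j3 y) (J j2 w) = T x (J j2 y) (J j3 w)) ->
  forall x y w, T x y w = 0.
Proof.
move=> JL Jinj J12 J31 J32 ss sss TZ T12 T23 E1 E2.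
have surj i v : exists u, J i u = v by exact: injective_endo_surj (JL i) (Jinj i) v.
have E1' x y w : T (J j1 x) (J j3 y) w = T (J j3 x) (J j1 y) w.
  by rewrite T12 T23 T12 E1 T12 T23 T12.
have E2' x y w : T (J j2 x) y (J j3 w) = T (J j3 x) y (J j2 w).
  by rewrite T12 -E2 T12.
(* The maps [J i] are onto, so arguments of this shape exhaust all triples. *)
suff Q0 x y w : T (J j3 (J j3 x)) (J j1 y) (J j2 w) = 0.
  move=> x y w; have [x' <-] := surj j3 x; have [x'' <-] := surj j3 x'.
  by have [y' <-] := surj j1 y; have [w' <-] := surj j2 w; exact: Q0.
have H : T (J j1 (J j2 x)) (J j3 y) (J j3 w) = s12 * T (J j2 (J j1 x)) (J j3 y) (J j3 w).
  by rewrite J12 TZ.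
move: H; rewrite E1' J32 TZ E2' E2' J31 TZ E1'.
set Q := T _ _ _ => /(congr1 ( *%R s23)).
have -> : s23 * (s12 * (s13 * Q)) = s12 * s13 * s23 * Q by ring.
by rewrite mulrA ss sss mul1r; lra.
Qed.

End SymmetricTrilinear.

(** * The [J]-map and the vanishing of symmetric prolongation maps *)

Section JMap.
Variables (R : realType) (V1 V2 : vectType R) (br : V1 -> V1 -> V2).
Variables (B1 : V1 -> V1 -> R) (B2 : V2 -> V2 -> R) (J : V2 -> V1 -> V1).
Hypotheses (MT : Mtype br B1 B2) (HJ : is_Jmap br B1 B2 J).

Lemma form_scale (V : lmodType R) (B : V -> V -> R) : nondeg_sym_form B ->
  forall c x y, B (c *: x) y = c * B x y.
Proof.
move=> [BL _ _] c x y; have B0 : B 0 y = 0.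
  by have := BL (-1) 0 0 y; rewrite scaler0 addr0 mulN1r addNr.
by have := BL c x 0 y; rewrite B0 !addr0.
Qed.

(** Linearity is tested against the non-degenerate form [B1], where it becomes bilinearity of the
    bracket. *)
Lemma Jmap_linear z : linmap (J z).
Proof.
case: MT => -[brL _ _ _] [B1L _ B1n] [B2L B2C _] a u v.
apply/subr0_eq/B1n => y.
rewrite addrC -scaleN1r B1L HJ B1L !HJ brL ![B2 z _]B2C B2L; ring.
Qed.

(* With [T_i(x, y, w) = B2 z_i (br (A x y) w) = B1 (J_i (A x y)) w], total
   symmetry says that [J_3^-1 J_1] and [J_3^-1 J_2] are self-adjoint for [T_3]
   in any two slots, whereas they anticommute by condition (C). *)
Lemma sym_prolongation_eq0 (A : V1 -> V1 -> V1) : condition_C J ->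
  (forall x y, A x y = A y x) -> (forall x y w, br (A x y) w = br (A x w) y) ->
  forall x y, A x y = 0.
Proof.
move=> [z [sg [_ Jinj JJ sg1 sgs]]] AC Abr.
case: MT => -[brL brC _ _] NB1 NB2; have [B1L B1C B1n] := NB1; have [B2L B2C _] := NB2.
have sq i j : sg i j * sg i j = 1 by case: (sg1 i j) => ->; rewrite ?mulrNN mulr1.
have B1Z := form_scale NB1.
have JJ' i j x : J (z j) (J (z i) x) = sg i j *: J (z i) (J (z j) x).
  by rewrite (JJ i j) scalerA sq scale1r.
have skew i x y : B1 (J (z i) x) y = - B1 x (J (z i) y).
  rewrite [B1 x _]B1C !HJ brC -scaleN1r ![B2 (z i) _]B2C (form_scale NB2); ring.
pose T i x y w := B1 (J (z i) (A x y)) w.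
have T12 i x y w : T i x y w = T i y x w by rewrite /T AC.
have T23 i x y w : T i x y w = T i x w y by rewrite /T !HJ Abr.
have TJ i j x y w : T i x y (J (z j) w) = sg i j * T j x y (J (z i) w).
  by rewrite /T !skew (JJ i j) [B1 _ (_ *: _)]B1C B1Z B1C; ring.
(* The detour goes through [T i x (J (z j) y) (J (z j) w)], which is symmetric in [y] and [w]; the
   sign [sg i j] enters twice and cancels. *)
have E i j x y w : T j x (J (z j) y) (J (z i) w) = T j x (J (z i) y) (J (z j) w).
  rewrite -[LHS]mul1r -(sq i j) -mulrA -TJ T23 TJ mulrA sq mul1r; exact: T23.
have T0 := @sym_trilinear_anticommuting_eq0 R V1 (T (inord 2)) (fun i => J (z i))
  (sg (inord 0) (inord 1)) (sg (inord 0) (inord 2)) (sg (inord 1) (inord 2))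
  (inord 0) (inord 1) (inord 2).
move=> x y; apply: (Jinj (inord 2)); apply: B1n => w.
apply: T0 => //.
- by move=> i; exact: Jmap_linear.
- by move=> c x' y' w'; rewrite T12 T23 [in RHS]T12 [in RHS]T23 /T B1C B1Z B1C.
Qed.

End JMap.

Unset Implicit Arguments.

Theorem theorem3p6 (R : realType) (V1 V2 : vectType R)
    (br : V1 -> V1 -> V2) (B1 : V1 -> V1 -> R) (B2 : V2 -> V2 -> R)
    (J : V2 -> V1 -> V1) :
  Mtype br B1 B2 ->
  is_Jmap br B1 B2 J ->
  (3 <= \dim {:V2})%N ->
  condition_C J ->
  rigid br.
Proof.
move=> MT HJ _ CJ L b g i1 i2 ext.
have [[brL brC brG br0] _ _] := MT.
apply: (rigid_criterion ext brL brC brG) => X gX X0.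
have deg_ad x y : g (-1) (b (i1 y) (b (i1 x) X)).
  have := degree_bracket ext (degree_i1 ext y) (degree_bracket ext (degree_i1 ext x) gX).
  by rewrite (_ : -1 + _ = -1).
(* [A (x, y)] represents [[y, [x, X]]], which has degree -1 because [X] has degree 1. *)
have /boolp.choice[A AE] : forall p : V1 * V1, exists v, b (i1 p.2) (b (i1 p.1) X) = i1 v.
  by move=> p; apply/(degree_m1 ext).
have A0 : forall x y, A (x, y) = 0.
  apply: (sym_prolongation_eq0 MT HJ CJ) => [x y|x y w].
    apply: (i1_inj ext); rewrite -!AE /=.
    by apply/subr0_eq; rewrite (ad_i2_br ext) X0.
  apply: (i2_inj ext); rewrite !(i2_br ext) -!AE /=.
  (* As [[y, w]] also annihilates [[x, X]], the brackets with [y] and [w] commute on it; this is the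
     remaining symmetry of [A]. *)
  have kill : b (i2 (br y w)) (b (i1 x) X) = 0.
    by rewrite (ad_i2_i1 ext) X0 (linmap0 (bracket_linear_r ext _)).
  apply: oppr_inj; rewrite -!(bracketC ext).
  by apply/esym/subr0_eq; rewrite (ad_i2_br ext).
have ad0 x y : b (i1 y) (b (i1 x) X) = 0.
  by rewrite (AE (x, y)) A0 (linmap0 (i1_linear ext)).
(* Transitivity is applied twice: to [X] in degree 1, then to [[x, X]] in degree 0. *)
apply: (transitive ext _ gX) => // x.
have gx := degree_bracket ext (degree_i1 ext x) gX.
by apply: (transitive ext _ gx) => // y; exact: ad0.
Qed.
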